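(* Let $G$ be a countable discrete nonamenable group containing a free subgroup on two generators, and let $G\curvearrowright X$ be a free, topologically amenable action by homeomorphisms on a compact metrizable space $X$. Then there exists a $G$-equivariant topological embedding of $X$ into $[0,1]^G$, where $G$ acts on $[0,1]^G$ by the left shift $(h\cdot y)_g=y_{h^{-1}g}$.
   Context: Let $\mathrm{Prob}(G)$ be the space of probability measures on $G$ equipped with the $\ell^1$-norm, with $G$ acting by left translation, $(g\mu)(h)=\mu(g^{-1}h)$. The action $G\curvearrowright X$ is topologically amenable if there is a sequence of continuous maps $\mu_n:X\to\mathrm{Prob}(G)$ such that $\sup_{x\in X}\|g\mu_n(x)-\mu_n(gx)\|_1\to 0$ as $n\to\infty$ for every $g\in G$. *)

(* Defs.v *)
From HB Require Import structures.
From mathcomp Require Import all_boot all_order all_algebra.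
From mathcomp Require Import all_classical all_reals all_analysis.
Import Order.TTheory GRing.Theory Num.Theory.
Import numFieldTopology.Exports.

Set Implicit Arguments.
Unset Strict Implicit.
Unset Printing Implicit Defensive.

Local Open Scope classical_set_scope.
Local Open Scope ring_scope.

(* A probability measure on the discrete space T is given by its mass function. *)
Record Prob (R : realType) (T : choiceType) := MkProb {
  mass :> T -> R ;
  mass_ge0 : forall t, 0 <= mass t ;
  mass_sum1 : (\esum_(t in [set: T]) (mass t)%:E = 1)%E }.

Section ell1_metric.
Variables (R : realType) (T : choiceType).
Implicit Types mu nu xi : Prob R T.

HB.instance Definition _ := gen_eqMixin (Prob R T).
HB.instance Definition _ := gen_choiceMixin (Prob R T).

Lemma Prob_ext mu nu : mu =1 nu -> mu = nu.
Proof.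
case: mu => m m0 m1; case: nu => n n0 n1 /= /funext mn.
by subst n; congr MkProb; exact: Prop_irrelevance.
Qed.

Definition ell1_dist mu nu : R :=
  fine (\esum_(t in [set: T]) `|mu t - nu t|%:E)%E.

(* The sum is at most 2, so that `fine` loses nothing in ell1_dist. *)
Lemma ell1_sum_le2 mu nu :
  (\esum_(t in [set: T]) `|mu t - nu t|%:E <= 2%:E)%E.
Proof.
apply: (@le_trans _ _ (\esum_(t in [set: T]) ((mu t)%:E + (nu t)%:E))%E).
  apply: le_esum => t _; rewrite -EFinD lee_fin.
  by rewrite (le_trans (ler_normB _ _))// !ger0_norm// mass_ge0.
by rewrite esumD ?mass_sum1 -?EFinD // => t _; rewrite lee_fin mass_ge0.
Qed.

Lemma ell1_distE mu nu :
  (ell1_dist mu nu)%:E = (\esum_(t in [set: T]) `|mu t - nu t|%:E)%E.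
Proof.
rewrite /ell1_dist fineK// ge0_fin_numE; last by apply: esum_ge0 => t _; rewrite lee_fin.
by rewrite (le_lt_trans (ell1_sum_le2 mu nu))// ltry.
Qed.

Lemma ell1_distxx mu : ell1_dist mu mu = 0.
Proof. by rewrite /ell1_dist esum1// => t _; rewrite subrr normr0. Qed.

Lemma ell1_dist_positivity mu nu : ell1_dist mu nu = 0 -> mu = nu.
Proof.
move=> d0; apply: Prob_ext => t; apply/eqP.
rewrite -subr_eq0 -normr_le0 -lee_fin -d0 ell1_distE.
apply: esum_ge; exists [set t]; first by split.
by rewrite fsbig_set1.
Qed.

Lemma ell1_dist_sym mu nu : ell1_dist mu nu = ell1_dist nu mu.
Proof. by congr fine; apply: eq_esum => t _; rewrite distrC. Qed.

Lemma ell1_dist_triangle nu mu xi :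
  ell1_dist mu xi <= ell1_dist mu nu + ell1_dist nu xi.
Proof.
rewrite -lee_fin EFinD !ell1_distE -esumD; do ?by move=> t _; rewrite lee_fin.
by apply: le_esum => t _; rewrite -EFinD lee_fin ler_distD.
Qed.

HB.instance Definition _ := @isMetric.Build R (Prob R T) ell1_dist
  ell1_distxx ell1_dist_positivity ell1_dist_sym ell1_dist_triangle.

End ell1_metric.

Section translation.
Variables (R : realType) (G : groupType).

Lemma translate_sum1 (g : G) (mu : Prob R G) :
  (\esum_(h in [set: G]) (mu (g^-1 * h)%g)%:E = 1)%E.
Proof.
rewrite -(mass_sum1 mu); apply/esym/reindex_esum; split => //.
- by move=> h k _ _ /mulgI.
- by move=> h _; exists (g * h)%g => //; rewrite mulKg.
Qed.

Definition translate (g : G) (mu : Prob R G) : Prob R G :=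
  MkProb (fun h => mass_ge0 mu (g^-1 * h)%g) (translate_sum1 g mu).

End translation.

Definition metrizable (R : realType) (X : topologicalType) : Prop :=
  exists d : X -> X -> R,
    [/\ forall x y, 0 <= d x y,
        forall x y, d x y = 0 <-> x = y,
        forall x y, d x y = d y x,
        forall x y z, d x z <= d x y + d y z &
        forall U : set X, open U <->
          forall x, U x -> exists2 e : R, 0 < e & [set y | d x y < e] `<=` U].

(* Each act g is a homeomorphism, with continuous inverse act g^-1. *)
Definition action_by_homeos (G : groupType) (X : topologicalType)
    (act : G -> X -> X) : Prop :=
  [/\ forall x, act 1%g x = x,
      forall g h x, act (g * h)%g x = act g (act h x) &
      forall g, continuous (act g)].

Definition free_action (G : groupType) (X : Type) (act : G -> X -> X) : Prop :=
  forall g x, act g x = x -> g = 1%g.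

(* The set of values is bounded by 2; for empty X the real supremum of the
   empty set is 0. *)
Definition topologically_amenable (R : realType) (G : groupType)
    (X : topologicalType) (act : G -> X -> X) : Prop :=
  exists mu : nat -> X -> Prob R G,
    (forall n, continuous (mu n)) /\
    forall g : G,
      sup (range (fun x => ell1_dist (translate g (mu n x)) (mu n (act g x))))
        @[n --> \oo] --> (0 : R).

(* von Neumann: G carries a left-invariant finitely additive probability
   measure defined on all of its subsets. *)
Definition amenable_group (R : realType) (G : groupType) : Prop :=
  exists m : set G -> R,
    [/\ forall A, 0 <= m A,
        m [set: G] = 1,
        forall A B, A `&` B = set0 -> m (A `|` B) = m A + m B &
        forall g A, m [set (g * h)%g | h in A] = m A].

(* Words in a, b and their inverses: a letter (i, e) is the generator a if i is
   false, b if i is true, inverted if e is true. *)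
Definition reduced_word : pred (seq (bool * bool)) :=
  sorted (fun s t => ~~ ((s.1 == t.1) && (s.2 != t.2))).

Definition word_value (G : groupType) (a b : G) (w : seq (bool * bool)) : G :=
  (\prod_(s <- w) (let x := if s.1 then b else a in if s.2 then x^-1 else x))%g.

(* H is free with basis (a, b): its elements are uniquely written as reduced
   words. *)
Definition freely_generated (G : groupType) (H : set G) (a b : G) : Prop :=
  set_bij [set w | reduced_word w] H (word_value a b).

Definition contains_free_subgroup2 (G : groupType) : Prop :=
  exists (H : set G) (a b : G), group_closed [in H] /\ freely_generated H a b.

Definition cube (R : realType) (G : Type) : topologicalType :=
  prod_topology (fun _ : G => set_type `[0 : R, 1]%classic).

Definition left_shift (R : realType) (G : groupType) (h : G) (y : cube R G) :
  cube R G := fun g => y (h^-1 * g)%g.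

Definition topological_embedding (X Y : topologicalType) (f : X -> Y) : Prop :=
  [/\ injective f, continuous f &
      forall U : set X, open U ->
        exists2 V : set Y, open V & f @` U = V `&` range f].

(* Main.v *)
(* Let A (resp. A') be the set of group elements whose reduced word, relative to
   a transversal of H \ G, starts with a (resp. a^-1).  The translates b^i A are
   pairwise disjoint, and so are the b^i a^-1 (G \ A), which lie in b^i A'.  An
   approximately equivariant mu : X -> Prob(G) turns this into a bump function h
   on X, equal to 1 where mu_x(A) is close to 1: the translates of h by v_i = b^i
   have disjoint supports, while the translates by w_i = b^i a^-1 (i < 4) of
   {h = 1} cover X.

   Hence functions F, g : X -> [0, 1] can be stored in one function f : X -> [0, 1]
   by f(v_None x) = h(x), f(v_(Some (true, i)) x) = h(x) F(w_i x) / 2 and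
   f(v_(Some (false, i)) x) = h(x) g(w_i x) / 2.  The value 1 is taken by f
   only at the points v_None x with h(x) = 1, so {h = 1}, and then F and g, can be
   read off from f along an orbit.  Since g is halved, f_n = encode F_n f_(n+1)
   has a continuous solution, and f_0 along the orbit of x determines all F_n(x).
   For (F_n) separating the points of X, x |-> (f_0(g^-1 x))_g is the embedding. *)

Require Import Defs.
From mathcomp Require Import all_boot all_order all_algebra.
From mathcomp Require Import all_classical all_reals all_analysis.
From mathcomp Require Import lra.

Import Order.TTheory GRing.Theory Num.Theory.
Import numFieldNormedType.Exports.

Set Implicit Arguments.
Unset Strict Implicit.
Unset Printing Implicit Defensive.

Local Open Scope classical_set_scope.
Local Open Scope ring_scope.

(** * Paradoxical pieces of a group containing a free group *)

Lemma reduced_word_cons s w :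
  reduced_word (s :: w) =
  (if w is t :: _ then ~~ ((s.1 == t.1) && (s.2 != t.2)) else true) &&
  reduced_word w.
Proof. by case: w. Qed.

(** The exponent of the leading power of b, [(true, false)] being the letter b. *)
Definition word_lead (w : seq (bool * bool)) : nat :=
  find (predC1 (true, false)) w.

(** [word h] is the reduced word of [h * (rep h)^-1], with [rep h] representing the coset H h; left
    multiplication by a letter stays in the coset. *)
Lemma free_group_words (G : groupType) : contains_free_subgroup2 G ->
  exists (a b : G) (word : G -> seq (bool * bool)),
  (forall h, reduced_word (word h)) /\ forall h s,
    reduced_word (s :: word h) -> word (word_value a b [:: s] * h)%g = s :: word h.
Proof.
case=> H [a [b [[H1 Hdiv] [Hval inj_val surj_val]]]].
have valH w : reduced_word w -> word_value a b w \in [in H].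
  by move=> rw; rewrite inE; apply: Hval.
have HM x y : x \in [in H] -> y \in [in H] -> (x * y)%g \in [in H].
  move=> xH yH; rewrite -[y]invgK; apply: (Hdiv) => //.
  by rewrite -[(y^-1)%g]mul1g; apply: (Hdiv).
have HV x : x \in [in H] -> (x^-1)%g \in [in H].
  by move=> xH; rewrite -[(x^-1)%g]mul1g; apply: Hdiv.
pose rep h := choose (fun k => (h * k^-1)%g \in [in H]) h.
have repP h : (h * (rep h)^-1)%g \in [in H].
  apply: (chooseP (P := fun k => (h * k^-1)%g \in [in H])).
  by rewrite /= mulgV.
(* [choose] depends neither on the form of the predicate nor on the default, so [rep] is constant on
   cosets. *)
have repM x h : x \in [in H] -> rep (x * h)%g = rep h.
  move=> xH; rewrite /rep.
  rewrite (@eq_choose _ _ (fun k => (h * k^-1)%g \in [in H])); last first.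
    move=> k; apply/idP/idP => [xhk|hk]; last by rewrite -mulgA HM.
    by rewrite -[(h * _)%g](mulKg x) HM ?HV// mulgA.
  apply: (@choose_id _ (fun k => (h * k^-1)%g \in [in H])); last by rewrite mulgV.
  by rewrite invgM mulgA mulgV mul1g HV.
have wordP h : {w | reduced_word w & word_value a b w = (h * (rep h)^-1)%g}.
  apply: cid2; have := repP h; rewrite inE => /surj_val[w rw <-].
  by exists w.
pose word h := s2val (wordP h).
exists a, b, word; split=> [h|h s rs]; first by rewrite /word; case: (wordP h).
have rs1 : reduced_word [:: s] by [].
apply: inj_val.
- by rewrite inE /word; case: (wordP _).
- by rewrite inE.
have wordE k : word_value a b (word k) = (k * (rep k)^-1)%g.
  by rewrite /word; case: (wordP k).
rewrite wordE repM ?valH// -mulgA -wordE /word_value.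
by rewrite !big_cons big_nil mulg1.
Qed.

(** The leading power of b in the word of [b ^+ i * h] recovers i. Prepending a^-1 to a word keeps
    it reduced unless the word starts with a. *)
Lemma paradoxical_pieces (G : groupType) : contains_free_subgroup2 G ->
  exists (a b : G) (A A' : set G),
  [/\ forall i j h k, A h -> A k -> (b ^+ i * h = b ^+ j * k)%g -> i = j,
      forall i j h k, A' h -> A' k -> (b ^+ i * h = b ^+ j * k)%g -> i = j &
      forall h, ~ A h -> A' (a^-1 * h)%g].
Proof.
move=> /free_group_words[a [b [word [word_red wordM]]]].
pose starts e := [set h | exists w, word h = (false, e) :: w].
have wordX e i h : starts e h ->
    word (b ^+ i * h)%g = nseq i (true, false) ++ word h.
  case=> w wh; elim: i => [|i IH]; first by rewrite mul1g.
  rewrite expgS -mulgA.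
  have step k : reduced_word ((true, false) :: word k) ->
    word (b * k)%g = (true, false) :: word k.
    by move=> /wordM; rewrite /word_value big_seq1.
  rewrite step ?IH// -IH.
  rewrite reduced_word_cons word_red andbT IH wh.
  by case: (i).
have leadX e i h : starts e h -> word_lead (word (b ^+ i * h)%g) = i.
  move=> sh; rewrite (wordX e)//; case: sh => w ->.
  by rewrite /word_lead; elim: i => //= i ->.
exists a, b, (starts false), (starts true); split.
- by move=> i j h k Ah Ak E; rewrite -(leadX _ i _ Ah) E (leadX _ _ _ Ak).
- by move=> i j h k Ah Ak E; rewrite -(leadX _ i _ Ah) E (leadX _ _ _ Ak).
move=> h nAh; exists (word h).
suff /wordM : reduced_word ((false, true) :: word h).
  by rewrite /word_value big_seq1.
rewrite reduced_word_cons word_red andbT; case wh: (word h) => [//|[[] []] w]//.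
by case: nAh; exists w.
Qed.

(** * Bump functions from topological amenability *)

Section mass_of_set.
Variables (R : realType) (T : choiceType).
Implicit Types (mu nu : Prob R T) (A : set T).

Definition mass_of mu A : R := fine (\esum_(t in A) (mu t)%:E)%E.

Lemma mass_ofE mu A : (mass_of mu A)%:E = (\esum_(t in A) (mu t)%:E)%E.
Proof.
have mu0 t : (0 <= (mu t)%:E)%E by rewrite lee_fin mass_ge0.
rewrite /mass_of fineK// ge0_fin_numE; last by apply: esum_ge0.
rewrite (@le_lt_trans _ _ 1%E) ?ltry// -(mass_sum1 mu).
by rewrite [leRHS](esumID A)// setTI leeDl// esum_ge0.
Qed.

(** After exchanging the sums, each point of T is counted at most once. *)
Lemma mass_of_sum_le1 (I : finType) mu (A : I -> set T) :
  (forall i j t, A i t -> A j t -> i = j) -> \sum_i mass_of mu (A i) <= 1.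
Proof.
move=> disjA; rewrite -lee_fin -(mass_sum1 mu) -sumEFin.
under eq_bigr do rewrite mass_ofE esum_mkcond.
rewrite -esum_sum; last first.
  by move=> t i _ _; case: ifP => // _; rewrite lee_fin mass_ge0.
apply: le_esum => t _.
case: (pselect (exists i, A i t)) => [[i Ait]|nA].
  rewrite (bigD1 i)//= mem_set// big1 ?adde0// => j ji.
  by rewrite memNset// => Ajt; rewrite (disjA _ _ _ Ajt Ait) eqxx in ji.
rewrite big1 ?lee_fin ?mass_ge0// => i _.
by rewrite memNset// => Ait; apply: nA; exists i.
Qed.

Lemma mass_ofC mu A : mass_of mu (~` A) = 1 - mass_of mu A.
Proof.
have mu0 t : (0 <= (mu t)%:E)%E by rewrite lee_fin mass_ge0.
apply/eqP; rewrite eq_sym subr_eq -eqe -(mass_sum1 mu) EFinD !mass_ofE addeC.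
by rewrite (esumID A)// !setTI.
Qed.

Lemma mass_of_dist mu nu A : mass_of mu A <= mass_of nu A + ell1_dist mu nu.
Proof.
rewrite -lee_fin EFinD !mass_ofE ell1_distE.
apply: (@le_trans _ _
  (\esum_(t in A) (nu t)%:E + \esum_(t in A) `|mu t - nu t|%:E)%E).
  rewrite -esumD => [||t _]; rewrite ?lee_fin ?mass_ge0//; last first.
    by move=> t _; rewrite lee_fin mass_ge0.
  apply: le_esum => t _; rewrite -EFinD lee_fin -lerBlDl.
  exact: ler_norm.
rewrite leeD2l// [leRHS](esumID A); last by move=> t _; rewrite lee_fin.
by rewrite setTI leeDl// esum_ge0// => t _; rewrite lee_fin.
Qed.

Lemma mass_of_continuous A : continuous (fun mu => mass_of mu A).
Proof.
move=> mu U /nbhs_ballP[e /= e0 eU].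
apply/nbhs_ballP; exists e => // nu; rewrite ballEmdist /= => munu.
have {}munu : ell1_dist mu nu < e by [].
apply: eU; rewrite /ball/= (le_lt_trans _ munu)// ler_norml; apply/andP; split.
  by rewrite lerBrDl lerBlDr ell1_dist_sym mass_of_dist.
by rewrite lerBlDl mass_of_dist.
Qed.

End mass_of_set.

Lemma mass_of_translate (R : realType) (G : groupType) (g : G) (mu : Prob R G)
    (A : set G) :
  mass_of (translate g mu) A = mass_of mu [set h | A (g * h)%g].
Proof.
apply: EFin_inj; rewrite !mass_ofE (@reindex_esum _ _ _ [set h | A (g * h)%g] _ (fun h => g * h)%g).
  by apply: eq_esum => h _ /=; rewrite mulKg.
split=> [h //|h k _ _ /mulgI //|h Ah].
by exists (g^-1 * h)%g; rewrite /= mulVKg.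
Qed.

Section bump.
Variables (R : realType) (G : groupType) (X : topologicalType).
Variable act : G -> X -> X.
Hypothesis actP : action_by_homeos act.

(** Convergence holds for each group element separately; for a finite family one index serves
    all. *)
Lemma approx_equivariant_map (I : finType) (g : I -> G) (e : R) : 0 < e ->
  topologically_amenable R act ->
  exists2 mu : X -> Prob R G, continuous mu &
    forall i x, ell1_dist (translate (g i) (mu x)) (mu (act (g i) x)) <= e.
Proof.
move=> e0 [mu [mu_cont mu_eq]].
have : \forall n \near \oo, forall i,
    sup (range (fun x =>
      ell1_dist (translate (g i) (mu n x)) (mu n (act (g i) x)))) < e.
  apply: filter_forall => i; have /cvgrPdist_lt/(_ _ e0) := mu_eq (g i).
  apply: filterS => n; rewrite sub0r normrN; apply: le_lt_trans.
  exact: ler_norm.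
case=> N _ /(_ N (leqnn N)) supN; exists (mu N); first exact: mu_cont.
move=> i x; apply: le_trans (ltW (supN i)); apply: ub_le_sup; last by exists x.
exists 2 => _ [y _ <-]; rewrite -lee_fin ell1_distE; exact: ell1_sum_le2.
Qed.

Lemma continuous_clamp (u : X -> R) (s t : R) : continuous u ->
  continuous (fun x => Num.max 0 (Num.min 1 (s * u x - t))).
Proof.
move=> cu x.
apply: (@continuous_max R X (fun=> 0) (fun x => Num.min 1 (s * u x - t))).
  exact: cvg_cst.
apply: (@continuous_min R X (fun=> 1) (fun x => s * u x - t)).
  exact: cvg_cst.
by apply: cvgB; [apply: cvgM; [exact: cvg_cst|exact: cu]|exact: cvg_cst].
Qed.

Lemma compressible_bump (n : nat) : topologically_amenable R act ->
  contains_free_subgroup2 G ->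
  exists (h : X -> R) (v : 'I_n -> G) (w : 'I_4 -> G),
  [/\ continuous h, forall x, 0 <= h x <= 1,
      forall i j y, i != j -> h (act (v i)^-1%g y) = 0 \/ h (act (v j)^-1%g y) = 0 &
      forall x, exists i, h (act (w i)^-1%g x) = 1].
Proof.
move=> am /paradoxical_pieces[a [b [A [A' [disjA disjA' AA']]]]].
have [act1 actM _] := actP.
have actK g x : act g (act g^-1%g x) = x by rewrite -actM mulgV act1.
pose v (i : 'I_n) := (b ^+ i)%g.
pose w (i : 'I_4) := (b ^+ i * a^-1)%g.
pose f (k : 'I_n + 'I_4) := match k with inl i => v i | inr i => (w i)^-1%g end.
have e0 : 0 < 1 / 20 :> R by lra.
have [mu mu_cont mu_eq] := approx_equivariant_map f e0 am.
pose m x := mass_of (mu x) A.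
(* The ramp rises from 0 at [m x = 6/10] to 1 at [m x = 7/10]. With error 1/20, disjointness needs
   6/10 - 1/20 > 1/2 and covering needs 1 - (1/4 + 1/20) >= 7/10. *)
pose h x := Num.max 0 (Num.min 1 (10 * m x - 6)).
exists h, v, w; split.
- apply: continuous_clamp => x.
  apply: (@continuous_comp _ _ _ mu (fun nu => mass_of nu A)).
    exact: mu_cont.
  exact: mass_of_continuous.
- by move=> x; rewrite /h le_max lexx /= ge_max ler01 ge_min lexx.
- move=> i j y ij.
  have big k : h (act (v k)^-1%g y) != 0 ->
      11 / 20 < mass_of (mu y) [set t | A ((v k)^-1 * t)%g].
    set z := act _ y => hz.
    have mz : 6 / 10 < m z.
      rewrite ltNge; apply: contra hz => mz.
      by rewrite /h max_l// ge_min; apply/orP; right; lra.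
    have := mu_eq (inl k) z; rewrite /= actK => d20.
    have := mass_of_dist (translate (v k) (mu z)) (mu y) [set t | A ((v k)^-1 * t)%g].
    rewrite mass_of_translate.
    rewrite (_ : [set t | _ (v k * t)%g] = A); last first.
      by apply/funext => t; rewrite /= mulKg.
    by rewrite -/(m z); lra.
  have [|/big hi] := eqVneq (h (act (v i)^-1%g y)) 0; first by left.
  have [|/big hj] := eqVneq (h (act (v j)^-1%g y)) 0; first by right.
  (* Two disjoint translates of A, indexed by [bool], cannot both have mass above 1/2. *)
  have disj (c c' : bool) t : A ((v (if c then i else j))^-1 * t)%g ->
      A ((v (if c' then i else j))^-1 * t)%g -> c = c'.
    move=> ct c't; have /ord_inj : nat_of_ord (if c then i else j) =
      nat_of_ord (if c' then i else j).
      by apply: disjA ct c't _; rewrite !mulVKg.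
    by case: c c' {ct c't} => -[]// E; rewrite E eqxx in ij.
  have := mass_of_sum_le1 (mu y) disj.
  by rewrite big_bool /=; lra.
- move=> x.
  have disj (i j : 'I_4) t : ~ A ((w i)^-1 * t)%g -> ~ A ((w j)^-1 * t)%g -> i = j.
    move=> /AA' it /AA' jt; apply/ord_inj; apply: disjA' it jt _.
    by rewrite !mulgA -/(w i) -/(w j) !mulgV.
  (* Four disjoint sets cannot all have mass above 1/4. *)
  have [i wi] : exists i, mass_of (mu x) [set t | ~ A ((w i)^-1 * t)%g] <= 1 / 4.
    apply: contrapT => /forallNP nw.
    have {}nw i : 1 / 4 < mass_of (mu x) [set t | ~ A ((w i)^-1 * t)%g].
      by rewrite ltNge; apply/negP/nw.
    have := mass_of_sum_le1 (A := fun i => [set t | ~ A ((w i)^-1 * t)%g]) (mu x) disj.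
    rewrite !big_ord_recl big_ord0.
    by have := (nw ord0, nw (lift ord0 ord0), nw (lift ord0 (lift ord0 ord0)),
      nw (lift ord0 (lift ord0 (lift ord0 ord0)))) => -[[[]]]; lra.
  exists i; set z := act _ x.
  have := mu_eq (inr i) x; rewrite /= -/z => d20.
  have := mass_of_dist (mu z) (translate (w i)^-1%g (mu x)) (~` A).
  rewrite mass_of_translate mass_ofC ell1_dist_sym => mz.
  have {}mz : 7 / 10 <= m z.
    by move: mz; rewrite -/(m z) /=; move: wi d20; rewrite /setC /=; lra.
  by rewrite /h min_l ?max_r ?ler01//; lra.
Qed.

End bump.

(** * Storing a sequence of functions in a single one *)

Section encoding.
Variables (R : realType) (G : groupType) (X : topologicalType).
Variable act : G -> X -> X.
Hypothesis actP : action_by_homeos act.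
Variables (I : finType) (w : I -> G) (v : option (bool * I) -> G).
Variable h : X -> R.
Hypothesis h_cont : continuous h.
Hypothesis h01 : forall x, 0 <= h x <= 1.
Hypothesis h_disj : forall i j y, i != j ->
  h (act (v i)^-1%g y) = 0 \/ h (act (v j)^-1%g y) = 0.
Hypothesis h_cover : forall x, exists i, h (act (w i)^-1%g x) = 1.

Let unit_valued (f : X -> R) := forall x, 0 <= f x <= 1.

Definition content (F g : X -> R) (k : option (bool * I)) (x : X) : R :=
  if k is Some (c, i) then (if c then F else g) (act (w i) x) / 2 else 1.

Definition encode (F g : X -> R) (y : X) : R :=
  \sum_k h (act (v k)^-1%g y) * content F g k (act (v k)^-1%g y).

Lemma encode_continuous F g :
  continuous F -> continuous g -> continuous (encode F g).
Proof.
have [_ _ act_cont] := actP.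
move=> cF cg; have cact f s : continuous f -> continuous (fun x => f (act s x) : R).
  by move=> cf x; apply: (@continuous_comp _ _ _ (act s) f); [exact: act_cont|exact: cf].
apply: (@continuous_big R _ _ 0 xpredT add_continuous) => k _ y.
apply: (@cvgM R X (nbhs y) _ (fun x => h (act (v k)^-1%g x))).
  exact: cact.
apply: (cact (content F g k)) => z.
case: k => [[c i]|]; last exact: cvg_cst.
by apply: cvgM; [case: c; exact: cact|exact: cvg_cst].
Qed.

(** The active slot k depends on y alone, so encodings of different functions can be compared slot
    by slot. *)
Lemma encode_form y : (forall F g, encode F g y = 0) \/
  exists2 k, h (act (v k)^-1%g y) != 0 &
    forall F g, encode F g y =
      h (act (v k)^-1%g y) * content F g k (act (v k)^-1%g y).
Proof.
have [[k hk]|h0] := pselect (exists k, h (act (v k)^-1%g y) != 0).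
  right; exists k => // F g; rewrite /encode (bigD1 k)//= big1 ?addr0// => j jk.
  have [->|hk0] := h_disj y jk; first by rewrite mul0r.
  by rewrite hk0 eqxx in hk.
left=> F g; rewrite /encode big1// => k _.
have [->|hk] := eqVneq (h (act (v k)^-1%g y)) 0; first by rewrite mul0r.
by case: h0; exists k.
Qed.

Lemma encode_at F g k x : h x != 0 ->
  encode F g (act (v k) x) = h x * content F g k x.
Proof.
have [act1 actM _] := actP.
have xE : act (v k)^-1%g (act (v k) x) = x by rewrite -actM mulVg act1.
move=> hx; rewrite /encode (bigD1 k)//= xE big1 ?addr0// => j jk.
have [->|] := h_disj (act (v k) x) jk; first by rewrite mul0r.
by rewrite xE => hx0; rewrite hx0 eqxx in hx.
Qed.

Lemma content_unit F g k : unit_valued F -> unit_valued g ->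
  unit_valued (content F g k).
Proof.
move=> F01 g01 x; case: k => [[[] i]|] /=; last by rewrite ler01 lexx.
  by have := F01 (act (w i) x); lra.
by have := g01 (act (w i) x); lra.
Qed.

Lemma encode_unit F g : unit_valued F -> unit_valued g ->
  unit_valued (encode F g).
Proof.
move=> F01 g01 y; have [->|[k _ ->]] := encode_form y; first by rewrite lexx ler01.
have /andP[c0 c1] := content_unit k F01 g01 (act (v k)^-1%g y).
have /andP[h0 h1] := h01 (act (v k)^-1%g y).
by rewrite mulr_ge0//= mulr_ile1.
Qed.

(** Since g enters halved and multiplied by h <= 1, errors in g are halved. *)
Lemma encode_le F g g' e : 0 <= e -> (forall x, g x <= g' x + e) ->
  forall y, encode F g y <= encode F g' y + e / 2.
Proof.
move=> e0 gg' y; have [E|[k _ E]] := encode_form y; rewrite !E; first by lra.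
set x := act _ y; have /andP[h0 h1] := h01 x.
have : forall z, content F g k z <= content F g' k z + e / 2.
  by move=> z; case: (k) => [[[] i]|] /=; [lra|have := gg' (act (w i) z); lra|lra].
by move=> /(_ x); nra.
Qed.

Lemma encode_separates F g : unit_valued F -> unit_valued g ->
  forall x y, (forall s, encode F g (act s x) = encode F g (act s y)) ->
  forall s, F (act s x) = F (act s y) /\ g (act s x) = g (act s y).
Proof.
have [act1 actM _] := actP.
move=> F01 g01 x y xy s; have [i hi] := h_cover (act s x).
set x' := act _ (act s x) in hi; pose y' := act (w i)^-1%g (act s y).
have xE : act s x = act (w i) x' by rewrite /x' -[RHS]actM mulgV act1.
have yE : act s y = act (w i) y' by rewrite /y' -[RHS]actM mulgV act1.
have {}xy t : encode F g (act t x') = encode F g (act t y').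
  by rewrite /x' /y' -!actM xy.
have hx0 : h x' != 0 by rewrite hi oner_eq0.
have marker : encode F g (act (v None) y') = 1.
  by rewrite -xy encode_at// hi mulr1.
(* Data slots yield at most 1/2, so the value 1 can only come from the slot [None], with h equal to
   1 at y'. *)
have hy : h y' = 1.
  move: marker; have [->|[[[c j]|] hk ->]] := encode_form (act (v None) y').
  - by move/esym/eqP; rewrite oner_eq0.
  - have := h01 (act (v (Some (c, j)))^-1%g (act (v None) y')).
    set u := act _ (act _ _) => hu /=.
    have : 0 <= (if c then F else g) (act (w j) u) <= 1 by case: c {hk hu} u.
    by nra.
  - by rewrite -actM mulVg act1 mulr1.
have hy0 : h y' != 0 by rewrite hy oner_eq0.
have read k : content F g k x' = content F g k y'.
  by have := xy (v k); rewrite !encode_at// hi hy !mul1r.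
rewrite xE yE; split.
  by have /= := read (Some (true, i)); lra.
by have /= := read (Some (false, i)); lra.
Qed.

(** * Iterated encoding of a sequence of functions *)

Variable F : nat -> X -> R.
Hypothesis F_cont : forall n, continuous (F n).
Hypothesis F01 : forall n, unit_valued (F n).

Fixpoint approx (k n : nat) : X -> R :=
  if k is k'.+1 then encode (F n) (approx k' n.+1) else fun=> 0.

Lemma approx_continuous k n : continuous (approx k n).
Proof.
elim: k n => [|k IH] n /=; first by move=> x; exact: cvg_cst.
exact: encode_continuous.
Qed.

Lemma approx_unit k n : unit_valued (approx k n).
Proof.
elim: k n => [|k IH] n /=; first by move=> x; rewrite lexx ler01.
exact: encode_unit.
Qed.

(** Each common encoding layer halves the discrepancy. Below these layers, the left function is 0,
    or the right one is 0 and the left one at most 1. *)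
Lemma approx_le j k n y : approx j n y <= approx k n y + 2^-1 ^+ k.
Proof.
elim: k j n y => [|k IH] [|j] n y.
- by rewrite expr0 /=; lra.
- by rewrite expr0 add0r; have /andP[] := approx_unit j.+1 n y.
- by rewrite addr_ge0 ?exprn_ge0//; have /andP[] := approx_unit k.+1 n y.
- by rewrite exprSr; apply: encode_le => //; rewrite exprn_ge0.
Qed.

(* The increasing limit of approx: the solution of f_n = encode F_n f_(n+1). *)
Definition nested_code (n : nat) (y : X) : R := sup (range (fun k => approx k n y)).

Lemma approx_le_code k n y : approx k n y <= nested_code n y.
Proof.
apply: ub_le_sup; last by exists k.
by exists 1 => _ [j _ <-]; have /andP[] := approx_unit j n y.
Qed.

Lemma code_le_approx k n y : nested_code n y <= approx k n y + 2^-1 ^+ k.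
Proof.
apply: ge_sup; first by exists (approx 0 n y), 0%N.
by move=> _ [j _ <-]; exact: approx_le.
Qed.

Lemma code_unit n : unit_valued (nested_code n).
Proof.
move=> y; have := approx_le_code 0 n y; have := code_le_approx 0 n y.
by rewrite expr0 /=; lra.
Qed.

Lemma exists_expr_half_lt (e : R) : 0 < e -> exists k, 2^-1 ^+ k < e.
Proof.
move=> e0; have [N _ /(_ N (leqnn N))] := near_infty_natSinv_expn_lt (PosNum e0).
by rewrite div1r -exprVn; exists N.
Qed.

(** Both sides lie between [approx k.+1 n] and [approx k.+1 n] plus 2^-(k+1), for every k. *)
Lemma code_eq n : nested_code n = encode (F n) (nested_code n.+1).
Proof.
apply/funext => y; apply/eqP; rewrite -subr_eq0 -normr_le0.
apply/ler_addgt0Pl => e /exists_expr_half_lt[k ke]; rewrite addr0.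
have k0 : 0 <= 2^-1 ^+ k :> R by rewrite exprn_ge0.
have /= := (approx_le_code k.+1 n y, code_le_approx k.+1 n y).
rewrite exprSr => -[l1 l2].
have l3 := encode_le (F n) k0 (code_le_approx k n.+1) y.
have l4 : encode (F n) (approx k n.+1) y <= encode (F n) (nested_code n.+1) y + 0 / 2.
  by apply: encode_le => // x; rewrite addr0 approx_le_code.
by rewrite ler_norml; apply/andP; split; lra.
Qed.

(** A uniform limit of the continuous functions [approx k n]. *)
Lemma code_continuous n : continuous (nested_code n).
Proof.
move=> x; apply/cvgrPdist_lt => e e0.
have [k ke] := @exists_expr_half_lt (e / 3) ltac:(lra).
have /cvgrPdist_lt/(_ (e / 3) ltac:(lra)) := @approx_continuous k n x.
apply: filterS => y; rewrite !ltr_norml.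
have := (approx_le_code k n x, code_le_approx k n x,
  approx_le_code k n y, code_le_approx k n y) => -[[[]]].
by move=> ? ? ? ? /andP[? ?]; apply/andP; split; lra.
Qed.

(** Layers are peeled off one at a time, with agreement kept along whole orbits because decoding at
    a point reads other points of its orbit. *)
Lemma code_separates x y : (forall s, nested_code 0 (act s x) = nested_code 0 (act s y)) ->
  forall n, F n x = F n y.
Proof.
move=> xy n.
have {}xy : forall s, nested_code n (act s x) = nested_code n (act s y).
  elim: n => // n IH s.
  have := encode_separates (F01 n) (code_unit n.+1) (x := x) (y := y).
  by rewrite -code_eq => /(_ IH s)[].
have := encode_separates (F01 n) (code_unit n.+1) (x := x) (y := y).
have [act1 _ _] := actP.
by rewrite -code_eq => /(_ xy 1%g)[]; rewrite !act1.
Qed.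

End encoding.

(** * The embedding *)

(** Truncated distances to the points of finite 2^-n-nets separate points. *)
Lemma metrizable_separating_functions (R : realType) (X : topologicalType) :
  compact [set: X] -> metrizable R X ->
  exists F : nat -> X -> R,
  [/\ forall n, continuous (F n), forall n x, 0 <= F n x <= 1 &
      forall x y, (forall n, F n x = F n y) -> x = y].
Proof.
move=> cX [d [d0 d_eq0 d_sym d_tri d_open]].
have ball_open x e : open [set y | d x y < e].
  apply/d_open => y /= xy; exists (e - d x y); first by rewrite subr_gt0.
  by move=> z /= yz; have := d_tri x y z; lra.
have net n : exists S : seq X, forall x, exists2 p, p \in S & d p x < 2^-1 ^+ n.
  (* Total boundedness: compactness as near covering, along the filter of finite
     sets; the library's compact_cover would require X to be pointed. *)
  pose Fin := filter_from setT (fun S : seq X => [set S' : seq X | {subset S <= S'}]).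
  have FinF : Filter Fin.
    apply: filter_fromT_filter => [|S S']; first by exists [::].
    by exists (S ++ S') => S2 /= sub; split=> p pS; apply: sub; rewrite mem_cat pS ?orbT.
  have /compact_near_coveringP/(_ _ Fin
    (fun S x => exists2 p, p \in S & d p x < 2^-1 ^+ n) FinF) := cX.
  case=> [x _|S _ /(_ S (fun _ => id)) cS]; last by exists S => x; exact: cS.
  exists ([set y | d x y < 2^-1 ^+ n], [set S : seq X | {subset [:: x] <= S}]) => /=.
    split; last by exists [:: x].
    apply: open_nbhs_nbhs; split; first exact: ball_open.
    by rewrite /= (d_eq0 x x).2 ?exprn_gt0.
  by move=> [y S] /= [xy xS]; exists x => //; apply: xS; rewrite mem_head.
have {net} [S netS] := choice net.
(* m encodes a pair (n, k), standing for the k-th point of the n-th net; an m that denotes no point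
   gives the zero function. *)
pose p m : option X := obind (fun nk : nat * nat => onth (S nk.1) nk.2) (unpickle m).
pose F m x : R := if p m is Some q then Num.min 1 (d q x) else 0.
have d_cont q : continuous (d q).
  move=> x; apply/cvgrPdist_lt => e e0.
  have : nbhs x [set y | d x y < e].
    by apply: open_nbhs_nbhs; split=> //=; rewrite (d_eq0 x x).2.
  apply: filterS => y /= xy; rewrite ltr_norml.
  have := d_tri q x y; have := d_tri q y x; rewrite (d_sym y x).
  by move=> ? ?; apply/andP; split; lra.
exists F; split.
- move=> m x; rewrite /F; case: (p m) => [q|]; last exact: cvg_cst.
  by apply: (@continuous_min R X (fun=> 1) (d q)); [exact: cvg_cst|exact: d_cont].
- move=> m x; rewrite /F; case: (p m) => [q|]; last by rewrite lexx ler01.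
  by rewrite le_min ler01 d0/= ge_min lexx.
move=> x y xy; apply/d_eq0/eqP; rewrite eq_le d0 andbT.
apply/ler_addgt0Pl => e e0; rewrite addr0.
(* The bound 1 makes the truncation inactive at x, hence at y; e / 2 serves the triangle inequality
   through q. *)
have [k ke] := exists_expr_half_lt (e := Num.min 1 (e / 2)) ltac:(rewrite lt_min; lra).
have [q qS qx] := netS k x.
have := xy (pickle (k, index q (S k))).
rewrite /F /p pickleK /= (_ : onth _ _ = Some q); last first.
  by rewrite onthE (nth_map q) ?index_mem// nth_index.
move: ke; rewrite lt_min => /andP[k1 k2].
rewrite min_r; last by lra.
have := d_tri x q y; rewrite (d_sym x q).
by have [|] := leP 1 (d q y); lra.
Qed.

Lemma cube_hausdorff (R : realType) (G : choiceType) : hausdorff_space (cube R G).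
Proof.
apply: hausdorff_product => _.
rewrite open_hausdorff => x y xy.
have : set_val x != set_val y by apply: contra xy => /eqP/val_inj ->.
have := @Rhausdorff R; rewrite open_hausdorff => H /H[[U V] [/= xU yV] [oU oV UV]].
exists (set_val @^-1` U, set_val @^-1` V); rewrite /= ?inE; first by move: xU yV; rewrite !inE.
split; [by exists U|by exists V|].
by rewrite -preimage_setI (eqP UV) preimage_set0.
Qed.

Lemma compact_topological_embedding (X Y : topologicalType) (f : X -> Y) :
  compact [set: X] -> hausdorff_space Y -> injective f -> continuous f ->
  topological_embedding f.
Proof.
move=> cX hY f_inj f_cont; split=> // U oU.
have clU : closed (f @` (~` U)).
  apply: compact_closed => //; apply: continuous_compact.
    exact: continuous_subspaceT f_cont.
  by apply: (subclosed_compact _ cX) => //; exact: open_closedC.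
exists (~` (f @` (~` U))); first exact: closed_openC.
apply/seteqP; split=> [_ [x Ux <-]|y [nUy [x _ xy]]].
  by split; [case=> y nUy /f_inj yx; apply: nUy; rewrite yx|exists x].
by exists x => //; apply: contrapT => nUx; apply: nUy; exists x.
Qed.

Theorem theorem2 (R : realType) (G : groupType) (X : topologicalType)
    (act : G -> X -> X)
    (countable_G : countable [set: G])
    (nonamenable_G : ~ amenable_group R G)
    (free_subgroup_G : contains_free_subgroup2 G)
    (compact_X : compact [set: X])
    (metrizable_X : metrizable R X)
    (action_act : action_by_homeos act)
    (free_act : free_action act)
    (amenable_act : topologically_amenable R act) :
  exists phi : X -> cube R G,
    topological_embedding phi /\
    forall (g : G) (x : X), phi (act g x) = left_shift g (phi x).
Proof.
have [F [F_cont F01 F_sep]] := metrizable_separating_functions compact_X metrizable_X.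
(* One translate per slot: a marker and two values for each of the four [w i]. *)
have [h [v [w [h_cont h01 h_disj h_cover]]]] := compressible_bump action_act
  #|{: option (bool * 'I_4)}| amenable_act free_subgroup_G.
pose u k := v (enum_rank k).
have h_disj_u i j y : i != j ->
    h (act (u i)^-1%g y) = 0 \/ h (act (u j)^-1%g y) = 0.
  by move=> ij; apply: h_disj; rewrite (inj_eq enum_rank_inj).
pose c := nested_code act w u h F 0.
have c_cont : continuous c by exact: code_continuous.
have c01 x : `[0, 1]%classic (c x) by rewrite /= in_itv /=; exact: code_unit.
pose phi x : cube R G := fun g => SigSub (mem_set (c01 (act g^-1%g x))).
have [_ actM act_cont] := action_act.
exists phi; split; last first.
  by move=> g x; apply/funext => k; apply/val_inj; rewrite /= -actM invgM invgK.
apply: compact_topological_embedding => //.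
- exact: cube_hausdorff.
- move=> x y xy; apply: F_sep; apply: (code_separates action_act h01 h_disj_u h_cover F01) => s.
  by have := congr1 (fun f : cube R G => val (f s^-1%g)) xy; rewrite /= invgK.
(* The cube has the supremum of the topologies induced by its coordinates, and [0,1] the one induced
   from the reals, so continuity reduces to that of x |-> c(g^-1 x). *)
- move=> x; apply/cvg_sup => g.
  move: x; apply/(@continuousP X (initial_topology (fun f : cube R G => f g)) phi).
  move=> _ [_ [B oB <-] <-].
  apply: (@open_comp _ _ (fun x => c (act g^-1%g x)) B) => // x _.
  by apply: (@continuous_comp _ _ _ (act g^-1%g) c); [exact: act_cont|exact: c_cont].
Qed.
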